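(* Let $n\ge 3$. The orthogonal matrix $$R=R_{n-1,n}\cdots R_{3,n}\cdots R_{34}\,R_{2,n}\cdots R_{24}R_{23},$$ a product of rotations $R_{ij}$ with angles $\theta_{ij}$ ($2\le i<j\le n$), gauges the standard Frenét frame into the natural frame, that is, $$\bar\omega(D_x)R-D_xR=R\,\omega(D_x).$$ This leads to the components of $\mathbf u=(u^{(1)},\dots,u^{(n-1)})^{\intercal}$ satisfying the Euler transformation $$u^{(1)}=\bar u^{(1)}\cos\theta_{23}\cos\theta_{24}\cdots\cos\theta_{2n},$$ $$u^{(2)}=\bar u^{(1)}\sin\theta_{23}\cos\theta_{24}\cdots\cos\theta_{2n},$$ and in general $$u^{(k)}=\bar u^{(1)}\sin\theta_{2,k+1}\prod_{l=k+2}^{n}\cos\theta_{2l},\qquad k=2,\dots,n-1$$ (so that $u^{(n-2)}=\bar u^{(1)}\sin\theta_{2,n-1}\cos\theta_{2n}$ for $n\ge 4$, and $u^{(n-1)}=\bar u^{(1)}\sin\theta_{2n}$), and to the curvatures in the standard Frenét frame satisfying $$\bar u^{(i)}=\prod_{j=i+2}^{n}\frac{\cos\theta_{i,j}}{\cos\theta_{i+1,j}}\;A_i,\qquad i=2,3,\dots,n-1,$$ where the $A_i$ are generated by the recursive relation $$A_i=D_x\theta_{i,i+1}+\sin\theta_{i-1,i+1}\,A_{i-1},\qquad A_1=0,\qquad 2\le i\le n-1.$$ There are $\tfrac12(n-2)(n-3)$ constraints on the rotating angles: $$D_x\theta_{ij}=\prod_{l=i+2}^{j}\frac{\cos\theta_{il}}{\cos\theta_{i+1,l}}\,\sin\theta_{i+1,j}\,A_i-\prod_{l=i+1}^{j-1}\frac{\cos\theta_{i-1,l}}{\cos\theta_{i,l}}\,\sin\theta_{i-1,j}\,A_{i-1},$$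 where $4\le j\le n$, $2\le i\le j-2$.
   Context: The setting is a curve parametrized by arclength $x$ in $n$-dimensional space, with two orthonormal frames along it: the Frenét frame $\bar{\mathbf e}$, with curvatures $\bar u^{(1)},\dots,\bar u^{(n-1)}$, and the natural (parallel) frame $\mathbf e$, with curvatures $u^{(1)},\dots,u^{(n-1)}$. $D_x$ is differentiation with respect to $x$ (applied entrywise to matrices). The Cartan matrix $\bar\omega(D_x)$ of the Frenét frame, defined by $\bar{\mathbf e}_x=\bar\omega(D_x)\bar{\mathbf e}$, is the antisymmetric tridiagonal $n\times n$ matrix with entries $\bar\omega_{i,i+1}=\bar u^{(i)}=-\bar\omega_{i+1,i}$ for $1\le i\le n-1$ and all other entries zero. The Cartan matrix of the natural frame, defined by $\mathbf e_x=\omega(D_x)\mathbf e$, is $$\omega(D_x)=\begin{pmatrix}0&\mathbf u^{\intercal}\\-\mathbf u&0\end{pmatrix},\qquad \mathbf u=(u^{(1)},\dots,u^{(n-1)})^{\intercal}.$$ The matrix $R$ is the transformation between the frames, $\bar{\mathbf e}=R\,\mathbf e$. For $2\le i<j\le n$, $R_{ij}$ is the orthogonal $n\times n$ matrix that keeps the first row and rotates the $i$-th and $j$-th rows with the angle $\theta_{ij}$ (a function of $x$): it agrees with the identity matrix except for $(R_{ij})_{ii}=(R_{ij})_{jj}=\cos\theta_{ij}$, $(R_{ij})_{ij}=\sin\theta_{ij}$, $(R_{ij})_{ji}=-\sin\theta_{ij}$. In the product defining $R$ the factors are, read from right to left, $R_{23},R_{24},\dots,R_{2n},R_{34},\dots,R_{3n},\dots,R_{n-1,n}$.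 Products whose index range is empty are equal to $1$; terms containing the factor $A_1=0$ vanish, although they formally contain nonexistent angles $\theta_{1,l}$.
   Formalization: The curvature formulas and angle constraints are proved where cos θ_ij ≠ 0 for 3 ≤ i < j (the denominators) and cos θ_2j ≠ 0 for j ≥ 5; without the latter the constraints can fail (n=5, θ_25=π/2, θ_23=0, θ_24=x, ū^(2)=0). *)

(* Defs.v *)
From HB Require Import structures.
From mathcomp Require Import all_boot all_order all_algebra.
From mathcomp Require Import all_classical all_reals all_analysis.
Set Implicit Arguments.
Unset Strict Implicit.
Unset Printing Implicit Defensive.
Import Order.TTheory GRing.Theory Num.Theory.
Import numFieldNormedType.Exports.
Local Open Scope classical_set_scope.
Local Open Scope ring_scope.

(* Angles [theta i j], curvatures [u k], [ubar k] and [A_rec theta i]      *)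
(* are indexed from 1 by natural numbers, and only the indices in the ranges *)
(* 2 <= i < j <= n, 1 <= k <= n - 1 matter; matrices are indexed by 'I_n, so *)
(* the index [i : 'I_n] stands for the position [i.+1].                      *)

Definition Dmx (R : realType) (m n : nat) (M : R -> 'M[R]_(m, n)) (x : R)
    : 'M[R]_(m, n) :=
  \matrix_(i, j) derive1 (fun y => M y i j) x.

Definition derivable_mx (R : realType) (m n : nat) (M : R -> 'M[R]_(m, n))
    (x : R) : Prop :=
  forall i j, derivable (fun y => M y i j) x 1.

Definition frenet_cartan (R : realType) (n : nat) (ubar : nat -> R -> R)
    (x : R) : 'M[R]_n :=
  \matrix_(i, j)
    if (j == i.+1 :> nat) then ubar i.+1 x
    else if (i == j.+1 :> nat) then - ubar j.+1 x
    else 0.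

Definition natural_cartan (R : realType) (n : nat) (u : nat -> R -> R)
    (x : R) : 'M[R]_n :=
  \matrix_(i, j)
    if (i == 0%N :> nat) && (0 < j)%N then u j x
    else if (j == 0%N :> nat) && (0 < i)%N then - u i x
    else 0.

Definition rotation (R : realType) (n i j : nat) (t : R) : 'M[R]_n :=
  \matrix_(a, b)
    if (a.+1 == i) && (b.+1 == i) || (a.+1 == j) && (b.+1 == j) then cos t
    else if (a.+1 == i) && (b.+1 == j) then sin t
    else if (a.+1 == j) && (b.+1 == i) then - sin t
    else (a == b)%:R.

(* (2,3), (2,4), ..., (2,n), (3,4), ..., (3,n), ..., (n-1,n), in this order. *)
Definition rotation_indices (n : nat) : seq (nat * nat) :=
  [seq (i, j) | i <- iota 2 (n - 2), j <- iota i.+1 (n - i)].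

(* The indices are reversed because [rotation_indices] lists the factors     *)
(* from right to left.                                                       *)
Definition gauge_mx (R : realType) (n : nat) (theta : nat -> nat -> R -> R)
    (x : R) : 'M[R]_n :=
  \big[@mulmx R n n n / 1%:M]_(p <- rev (rotation_indices n))
    rotation n p.1 p.2 (theta p.1 p.2 x).

(* The rows of [E x] are the vectors of the frame at the point of arclength  *)
(* parameter [x]; [c] is the curve and [w] the Cartan matrix.                *)
Definition moving_frame (R : realType) (n : nat) (I : set R)
    (c : R -> 'rV[R]_n) (w : R -> 'M[R]_n) (E : R -> 'M[R]_n) : Prop :=
  forall x, I x ->
  [/\ E x *m (E x)^T = 1%:M,
      derivable_mx c x,
      forall i : 'I_n, i = 0%N :> nat -> row i (E x) = Dmx c x,
      derivable_mx E x
    & Dmx E x = w x *m E x].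

Definition frenet_frame (R : realType) (n : nat) (I : set R)
    (c : R -> 'rV[R]_n) (ubar : nat -> R -> R) (E : R -> 'M[R]_n) : Prop :=
  moving_frame I c (frenet_cartan n ubar) E.

Definition natural_frame (R : realType) (n : nat) (I : set R)
    (c : R -> 'rV[R]_n) (u : nat -> R -> R) (E : R -> 'M[R]_n) : Prop :=
  moving_frame I c (natural_cartan n u) E.

Definition gauge_equation (R : realType) (n : nat)
    (theta : nat -> nat -> R -> R) (ubar u : nat -> R -> R) (x : R) : Prop :=
  frenet_cartan n ubar x *m gauge_mx n theta x - Dmx (gauge_mx n theta) x
  = gauge_mx n theta x *m natural_cartan n u x.

Fixpoint A_rec (R : realType) (theta : nat -> nat -> R -> R) (i : nat)
    (x : R) : R :=
  match i with
  | 0%N | 1%N => 0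
  | k.+1 => derive1 (theta k.+1 k.+2) x + sin (theta k k.+2 x) * A_rec theta k x
  end.

Definition euler_transformation (R : realType) (n : nat)
    (theta : nat -> nat -> R -> R) (ubar u : nat -> R -> R) (x : R) : Prop :=
  u 1%N x = ubar 1%N x * \prod_(3 <= l < n.+1) cos (theta 2%N l x) /\
  forall k, (2 <= k <= n.-1)%N ->
    u k x = ubar 1%N x * sin (theta 2%N k.+1 x)
            * \prod_(k.+2 <= l < n.+1) cos (theta 2%N l x).

Definition frenet_curvatures (R : realType) (n : nat)
    (theta : nat -> nat -> R -> R) (ubar : nat -> R -> R) (x : R) : Prop :=
  forall i, (2 <= i <= n.-1)%N ->
    ubar i x =
      \prod_(i.+2 <= j < n.+1) (cos (theta i j x) / cos (theta i.+1 j x))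
      * A_rec theta i x.

Definition constraint_index (n i j : nat) : bool :=
  (4 <= j <= n)%N && (2 <= i <= j - 2)%N.

(* For [i = 2] the second term contains the nonexistent angles [theta 1 l],  *)
(* but its factor [A_rec theta 1 x] is 0.                                    *)
Definition angle_constraints (R : realType) (n : nat)
    (theta : nat -> nat -> R -> R) (x : R) : Prop :=
  forall i j, constraint_index n i j ->
    derive1 (theta i j) x =
      \prod_(i.+2 <= l < j.+1) (cos (theta i l x) / cos (theta i.+1 l x))
        * sin (theta i.+1 j x) * A_rec theta i x
      - \prod_(i.+1 <= l < j) (cos (theta i.-1 l x) / cos (theta i l x))
        * sin (theta i.-1 j x) * A_rec theta i.-1 x.

(* The nondegeneracy implicit in the quotients of cosines: the angles        *)
(* [theta i j] with [3 <= i] occur in denominators, and where                *)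
(* [cos (theta 2 j x) = 0] for some [5 <= j] the map from the angles to the  *)
(* rotations is so singular that the gauge equation no longer determines     *)
(* the derivatives as stated. [theta 2 3] and [theta 2 4] are unrestricted.  *)
Definition regular_angles (R : realType) (n : nat)
    (theta : nat -> nat -> R -> R) (x : R) : Prop :=
  forall i j, (2 <= i < j)%N -> (j <= n)%N -> (3 <= i)%N || (5 <= j)%N ->
    cos (theta i j x) != 0.

(* Main.v *)
Require Import Defs.
From mathcomp Require Import all_boot all_order all_algebra.
From mathcomp Require Import all_classical all_reals all_analysis.
From mathcomp Require Import zify ring.
Import Order.TTheory GRing.Theory Num.Theory.
Import numFieldNormedType.Exports.
Local Open Scope classical_set_scope.
Local Open Scope ring_scope.

(** Write the gauge matrix as T = T_2, where T_k = T_(k+1) P_k and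
    P_k = R_kn ... R_(k,k+1) collects the factors with first index k. Since T
    fixes e_1 and preserves its orthogonal complement, the gauge equation
    decouples ([gauge_split]). Its first row says that the natural curvatures
    are the first Frenet curvature times the second row of T, which is the row
    e_2 P_2 of products of sines and cosines: the Euler transformation. The
    rest is D T = Omega T, with Omega the Frenet matrix without its first row
    and column.

    That equation is unwound one block at a time. With the logarithmic
    derivative L_k(psi) = P_k^-1 P_k' of the block, linear in the angular
    velocities psi_j of its angles, suppose that
    D T_k + T_k L_k(b) = Omega_k T_k for some coefficients b (for k = 2, b = 0).
    Removing P_k on the right turns this into
    D T_(k+1) + T_(k+1) G_k(phi) = Omega_k T_(k+1), where phi = theta_k' + b and
    G_k(phi) = P_k L_k(phi) P_k^-1. The row k of this equation says that phi is
    a definite multiple of the row e_(k+1) P_(k+1), entry by entry and up to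
    cosines; solving for phi gives the formula for the k-th Frenet curvature
    and, for j > k+1, the constraint on theta_kj', whereas the entry j = k+1
    reproduces the recursion for A_k ([level_unique]). For such a phi,
    [space_spin_level] shows that
    G_k(phi) = ubar_k e_k ^ (e_(k+1) P_(k+1)) + L_(k+1)(b') with new
    coefficients b', namely the second term of the constraints at level k+1.
    The wedge product cancels the entries of Omega_k in row and column k, and
    the equation for k+1 is left. All steps are equivalences under the
    nonvanishing of the cosines ([level_step], [tail_equation_levels]). *)

Section Gauge.
Set Implicit Arguments.
Unset Strict Implicit.
Unset Printing Implicit Defensive.

Variables (R : realType) (n : nat).
Implicit Types (i j k l m : nat) (a b f : 'rV[R]_n) (M N : 'M[R]_n).
Implicit Types (x y : R) (c s psi phi : nat -> R) (t : nat -> nat -> R).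

Lemma from_ind (P : nat -> Prop) i : P i ->
  (forall m, (i <= m)%N -> P m -> P m.+1) -> forall m, (i <= m)%N -> P m.
Proof.
move=> P0 PS m /subnK <-; elim: (m - i)%N => [//|d IHd].
by rewrite addSn; apply: PS => //; rewrite leq_addl.
Qed.

Lemma down_ind (P : nat -> Prop) : P n ->
  (forall k, (k < n)%N -> P k.+1 -> P k) -> forall k, (k <= n)%N -> P k.
Proof.
move=> P0 PS k le_kn; rewrite -(subKn le_kn).
elim: (n - k)%N (leq_subr k n) => [|d IHd] lt_dn; first by rewrite subn0.
apply: PS; first by lia.
by rewrite subnSK //; apply: IHd; rewrite ltnW.
Qed.

(** * Row vectors and infinitesimal rotations *)

(** The positions count from 1, as in the indexing of angles and curvatures;
    outside 1..n this vector is 0. *)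
Definition evec k : 'rV[R]_n := \row_b (b.+1 == k)%:R.

Lemma evec_ord (p : 'I_n) : evec p.+1 = delta_mx 0 p.
Proof. by apply/rowP => q; rewrite !mxE eqSS eqxx. Qed.

Lemma evec_dot i j : (0 < i <= n)%N ->
  evec i *m (evec j)^T = (i == j)%:R%:M.
Proof.
case: i => // i /= lt_in; rewrite (evec_ord (Ordinal lt_in)) -rowE.
by apply/rowP => q; rewrite !mxE ord1 eqxx.
Qed.

Lemma evec_eq M N :
  (forall k, (0 < k <= n)%N -> evec k *m M = evec k *m N) -> M = N.
Proof.
move=> eqMN; apply/row_matrixP => p; rewrite !rowE -evec_ord.
exact/eqMN/ltn_ord.
Qed.

(** The antisymmetric matrices a ^ b span the Lie algebra of the rotation
    group; [wedge (evec i) (evec j)] generates the rotations of the plane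
    spanned by positions [i] and [j], and conjugation acts on both factors. *)
Definition wedge a b : 'M[R]_n := a^T *m b - b^T *m a.

Lemma wedgeDl a a' b : wedge (a + a') b = wedge a b + wedge a' b.
Proof. by rewrite /wedge linearD mulmxDl mulmxDr opprD addrACA. Qed.

Lemma wedgeZl x a b : wedge (x *: a) b = x *: wedge a b.
Proof. by rewrite /wedge linearZ /= -scalemxAl -scalemxAr scalerBr. Qed.

Lemma wedgeC a b : wedge b a = - wedge a b.
Proof. by rewrite /wedge opprB. Qed.

Lemma wedgeDr a b b' : wedge a (b + b') = wedge a b + wedge a b'.
Proof. by rewrite wedgeC wedgeDl opprD -!(wedgeC _ a). Qed.

Lemma wedgeZr x a b : wedge a (x *: b) = x *: wedge a b.
Proof. by rewrite wedgeC wedgeZl -scalerN -wedgeC. Qed.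

Lemma wedgeaa a : wedge a a = 0.
Proof. exact: subrr. Qed.

Lemma wedge_conj M a b : M^T *m wedge a b *m M = wedge (a *m M) (b *m M).
Proof. by rewrite /wedge mulmxBr mulmxBl !trmx_mul !mulmxA. Qed.

Lemma wedge_conj_tr M a b :
  M *m wedge a b *m M^T = wedge (a *m M^T) (b *m M^T).
Proof. by rewrite -wedge_conj trmxK. Qed.

Lemma mul_wedge f a b x y : f *m a^T = x%:M -> f *m b^T = y%:M ->
  f *m wedge a b = x *: b - y *: a.
Proof. by move=> fa fb; rewrite mulmxBr !mulmxA fa fb !mul_scalar_mx. Qed.

Lemma evec_wedge k i j : (0 < k <= n)%N ->
  evec k *m wedge (evec i) (evec j)
  = (k == i)%:R *: evec j - (k == j)%:R *: evec i.
Proof. by move=> hk; apply: mul_wedge; apply: evec_dot. Qed.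

(** The closed form of x_m = c_m x_(m-1) + s_m e_m, the recursion produced by
    rotating a fixed vector successively into the directions e_m. *)
Definition chain c s k m : 'rV[R]_n :=
  \sum_(k <= j < m.+1) (s j * \prod_(j.+1 <= l < m.+1) c l) *: evec j.

Lemma chain_geq c s k m : (m < k)%N -> chain c s k m = 0.
Proof. by move=> lt_mk; rewrite /chain big_geq. Qed.

Lemma chain_recr c s k m : (k <= m.+1)%N ->
  chain c s k m.+1 = c m.+1 *: chain c s k m + s m.+1 *: evec m.+1.
Proof.
move=> le_km; rewrite /chain big_nat_recr //= [X in _ * X]big_geq // mulr1.
rewrite scaler_sumr; congr (_ + _); apply: eq_big_nat => j /andP[_ lt_jm].
by rewrite big_nat_recr //= scalerA mulrA mulrC.
Qed.

Lemma chainE c s k m (p : 'I_n) :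
  chain c s k m 0 p =
  if (k <= p.+1 < m.+1)%N then s p.+1 * \prod_(p.+2 <= l < m.+1) c l else 0.
Proof.
rewrite /chain summxE.
rewrite -(big_nat1_eq +%R (fun j => s j * \prod_(j.+1 <= l < m.+1) c l)).
rewrite big_mkcond; apply: eq_bigr => j _.
by rewrite !mxE eq_sym; case: eqP => [->|_]; rewrite ?mulr1 ?mulr0.
Qed.

Lemma chain_fix M c s k m :
  (forall j, (k <= j <= m)%N -> evec j *m M = evec j) ->
  chain c s k m *m M = chain c s k m.
Proof.
move=> fixM; rewrite /chain mulmx_suml; apply: eq_big_nat => j ltj.
by rewrite -scalemxAl fixM.
Qed.

Lemma chain_dot c s k m j : (0 < j <= n)%N -> ~~ (k <= j <= m)%N ->
  evec j *m (chain c s k m)^T = 0%:M.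
Proof.
move=> hj hout; rewrite /chain raddf_sum mulmx_sumr raddf0 big_nat.
rewrite big1 // => q hq.
rewrite /= linearZ /= -scalemxAr evec_dot //; case: eqP => [ejq|_].
  by move: hout; rewrite ejq -ltnS hq.
by rewrite raddf0 scaler0.
Qed.

(** * Plane rotations *)

Lemma trmx_rotation i j x : (i != j)%N ->
  (rotation n i j x)^T = rotation n i j (- x).
Proof.
move=> neq_ij; apply/matrixP => p q; rewrite !mxE cosN sinN opprK.
rewrite [in LHS](eq_sym q p).
case: (eqVneq p.+1 i) (eqVneq p.+1 j) (eqVneq q.+1 i) (eqVneq q.+1 j)
  => [->|_] [ej1|_] [->|_] [ej2|_] //=; rewrite ?eqxx ?(negbTE neq_ij) //=.
Qed.

Lemma evec_rotation_fst i j x : (0 < i < j)%N -> (j <= n)%N ->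
  evec i *m rotation n i j x = cos x *: evec i + sin x *: evec j.
Proof.
case: i => // i /= lt_ij le_jn.
have lt_in : (i < n)%N by exact: leq_trans (ltnW lt_ij) le_jn.
rewrite (evec_ord (Ordinal lt_in)) -rowE; apply/rowP => q; rewrite !mxE /=.
rewrite !eqxx (ltn_eqF lt_ij) /= orbF -!val_eqE /= eqSS [(i == q :> nat)]eq_sym.
case: (eqVneq (q : nat) i) => [->|_] /=.
  by rewrite (ltn_eqF lt_ij) mulr1 mulr0 addr0.
by rewrite mulr0 add0r; case: eqP; rewrite ?mulr1 ?mulr0.
Qed.

Lemma evec_rotation_snd i j x : (0 < i < j)%N -> (j <= n)%N ->
  evec j *m rotation n i j x = - sin x *: evec i + cos x *: evec j.
Proof.
case: j => [|j]; first by rewrite ltn0 andbF.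
move=> /andP[_ lt_ij] lt_jn.
rewrite (evec_ord (Ordinal lt_jn)) -rowE; apply/rowP => q; rewrite !mxE /=.
rewrite !eqxx (gtn_eqF lt_ij) /= -!val_eqE /= eqSS [(j == q :> nat)]eq_sym.
case: (eqVneq (q : nat) j) => [->|_] /=.
  by rewrite (gtn_eqF lt_ij) mulr1 mulr0 add0r.
by rewrite mulr0 addr0; case: eqP; rewrite ?mulr1 ?mulr0.
Qed.

Lemma evec_rotation i j x k : k != i -> k != j ->
  evec k *m rotation n i j x = evec k.
Proof.
move=> neq_ki neq_kj.
have [/andP[k_gt0 le_kn]|/negbTE hk] := boolP (0 < k <= n)%N; last first.
  suff -> : evec k = 0 by rewrite mul0mx.
  apply/rowP => p; rewrite !mxE; case: eqP => // ek.
  by move: hk; rewrite -ek ltn_ord.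
case: k k_gt0 le_kn neq_ki neq_kj => // k _ lt_kn neq_ki neq_kj.
rewrite (evec_ord (Ordinal lt_kn)) -rowE; apply/rowP => q; rewrite !mxE /=.
by rewrite (negbTE neq_ki) (negbTE neq_kj) /= eq_sym.
Qed.

Lemma mul_rotation_opp i j x : (0 < i < j)%N -> (j <= n)%N ->
  rotation n i j x *m rotation n i j (- x) = 1%:M.
Proof.
move=> hij le_jn; apply: evec_eq => k hk; rewrite mulmxA mulmx1.
have [->|nki] := eqVneq k i.
  rewrite evec_rotation_fst // mulmxDl -!scalemxAl evec_rotation_fst //.
  rewrite evec_rotation_snd // cosN sinN !scalerDr !scalerA addrACA -!scalerDl.
  rewrite [X in X *: evec i](_ : _ = 1); last by rewrite -(cos2Dsin2 x); ring.
  rewrite [X in X *: evec j](_ : _ = 0); last by ring.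
  by rewrite scale1r scale0r addr0.
have [->|nkj] := eqVneq k j; last by rewrite !evec_rotation.
rewrite evec_rotation_snd // mulmxDl -!scalemxAl evec_rotation_fst //.
rewrite evec_rotation_snd // cosN sinN !scalerDr !scalerA addrACA -!scalerDl.
rewrite [X in X *: evec j](_ : _ = 1); last by rewrite -(cos2Dsin2 x); ring.
rewrite [X in X *: evec i](_ : _ = 0); last by ring.
by rewrite scale1r scale0r add0r.
Qed.

Lemma rotation_orth i j x : (0 < i < j)%N -> (j <= n)%N ->
  rotation n i j x *m (rotation n i j x)^T = 1%:M.
Proof.
move=> hij le_jn; rewrite trmx_rotation ?mul_rotation_opp //.
by case/andP: hij => _ /ltn_eqF ->.
Qed.

Lemma rotation_conj_wedge i j x : (0 < i < j)%N -> (j <= n)%N ->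
  rotation n i j x *m wedge (evec i) (evec j) *m (rotation n i j x)^T
  = wedge (evec i) (evec j).
Proof.
move=> hij le_jn; rewrite trmx_rotation; last first.
  by case/andP: hij => _ /ltn_eqF ->.
have -> : rotation n i j x = (rotation n i j (- x))^T.
  by rewrite trmx_rotation ?opprK //; case/andP: hij => _ /ltn_eqF ->.
rewrite wedge_conj evec_rotation_fst // evec_rotation_snd // cosN sinN opprK.
rewrite !(wedgeDl, wedgeDr, wedgeZl, wedgeZr) !wedgeaa !scaler0 add0r addr0.
rewrite (wedgeC (evec i)) !scalerN scaleNr opprK !scalerA -scalerDl.
by rewrite -!expr2 cos2Dsin2 scale1r.
Qed.

(** * Blocks of rotations sharing their first index *)

Definition mulmxs T (r : seq T) (F : T -> 'M[R]_n) : 'M[R]_n :=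
  \big[@mulmx R n n n / 1%:M]_(p <- r) F p.

Lemma mulmxs_cat T (r1 r2 : seq T) F :
  mulmxs (r1 ++ r2) F = mulmxs r1 F *m mulmxs r2 F.
Proof.
rewrite /mulmxs; elim: r1 => [|p r1 IHr]; first by rewrite big_nil mul1mx.
by rewrite /= !big_cons IHr mulmxA.
Qed.

Definition block t i m : 'M[R]_n :=
  mulmxs (rev (iota i.+1 (m - i))) (fun j => rotation n i j (t i j)).

Lemma block_id t i : block t i i = 1%:M.
Proof. by rewrite /block subnn /mulmxs big_nil. Qed.

Lemma block_recr t i m : (i <= m)%N ->
  block t i m.+1 = rotation n i m.+1 (t i m.+1) *m block t i m.
Proof.
move=> le_im; rewrite /block subSn // -[(m - i).+1]addn1 iotaD rev_cat.
rewrite mulmxs_cat.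
by rewrite {1}/mulmxs big_cons big_nil mulmx1 addSn subnKC.
Qed.

Lemma evec_block_other t i m k : (k < i)%N || (m < k)%N -> (i <= m)%N ->
  evec k *m block t i m = evec k.
Proof.
move=> hk le_im; move: m le_im hk; apply: from_ind => [_|m le_im IHm hk].
  by rewrite block_id mulmx1.
rewrite block_recr // mulmxA evec_rotation.
- by apply: IHm; lia.
- by apply/eqP; lia.
- by apply/eqP; lia.
Qed.

Lemma block_orth t i m : (0 < i <= m)%N -> (m <= n)%N ->
  block t i m *m (block t i m)^T = 1%:M.
Proof.
case/andP=> i_gt0; move: m; apply: from_ind => [_|m le_im IHm lt_mn].
  by rewrite block_id trmx1 mulmx1.
rewrite block_recr // trmx_mul mulmxA -(mulmxA _ (block t i m)).
by rewrite IHm ?mulmx1 ?rotation_orth // ?i_gt0 // ltnW.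
Qed.

(** The factor besides the cosines in the coefficient of position [j] in the row
    vector that the block produces out of e_i; putting 1 at [j = i] gives the
    leading coefficient, which has no sine, the same shape as the others. *)
Definition sin1 t i j : R := if j == i then 1 else sin (t i j).

Definition arm t i m : 'rV[R]_n := chain (fun l => cos (t i l)) (sin1 t i) i m.

Lemma arm_id t i : arm t i i = evec i.
Proof. by rewrite /arm /chain big_nat1 big_geq // /sin1 eqxx mulr1 scale1r. Qed.

Lemma arm_recr t i m : (i <= m)%N ->
  arm t i m.+1 = cos (t i m.+1) *: arm t i m + sin (t i m.+1) *: evec m.+1.
Proof.
by move=> le_im; rewrite /arm chain_recr 1?leqW // {2}/sin1 gtn_eqF.
Qed.

Lemma evec_block t i m : (0 < i <= m)%N -> (m <= n)%N ->
  evec i *m block t i m = arm t i m.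
Proof.
case/andP=> i_gt0; move: m; apply: from_ind => [_|m le_im IHm lt_mn].
  by rewrite block_id mulmx1 arm_id.
rewrite block_recr // mulmxA evec_rotation_fst ?i_gt0 //.
rewrite mulmxDl -!scalemxAl IHm 1?ltnW // evec_block_other ?ltnSn ?orbT //.
by rewrite arm_recr.
Qed.

(** The logarithmic derivative P^-1 P' of the block P = [block t i m] when
    its angles move with velocities [psi] (see [is_dmx_block]): the angle of
    R_ij turns the plane of e_j and of the row e_i R_(i,j-1) ... R_(i,i+1).
    As a function of [psi] it also serves for coefficients that are not
    velocities. *)
Definition body_spin t i psi m : 'M[R]_n :=
  \sum_(i.+1 <= j < m.+1) psi j *: wedge (arm t i j.-1) (evec j).

Lemma body_spin_id t i psi : body_spin t i psi i = 0.
Proof. by rewrite /body_spin big_geq. Qed.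

Lemma body_spin_recr t i psi m : (i <= m)%N ->
  body_spin t i psi m.+1
  = body_spin t i psi m + psi m.+1 *: wedge (arm t i m) (evec m.+1).
Proof. by move=> le_im; rewrite /body_spin big_nat_recr. Qed.

Lemma body_spinD t i psi phi m :
  body_spin t i (fun j => psi j + phi j) m
  = body_spin t i psi m + body_spin t i phi m.
Proof.
by rewrite /body_spin -big_split; apply: eq_bigr => j _; rewrite scalerDl.
Qed.

Lemma body_spin0 t i psi m : (forall j, (i < j <= m)%N -> psi j = 0) ->
  body_spin t i psi m = 0.
Proof.
move=> psi0; rewrite /body_spin big_nat big1 // => j hj.
by rewrite psi0 ?scale0r.
Qed.

Lemma evec_body_spin_other t i psi m k : (0 < k <= n)%N ->
  (k < i)%N || (m < k)%N ->
  evec k *m body_spin t i psi m = 0.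
Proof.
move=> k_in hk; rewrite /body_spin mulmx_sumr big_nat big1 // => j hj.
rewrite -scalemxAr (mul_wedge (x := 0) (y := 0)).
- by rewrite !scale0r subrr scaler0.
- by rewrite chain_dot //; lia.
- by rewrite evec_dot // (_ : k == j = false) //; lia.
Qed.

Lemma body_spin_conj M t i psi m :
  (forall j, (i <= j <= m)%N -> evec j *m M = evec j) ->
  M^T *m body_spin t i psi m *m M = body_spin t i psi m.
Proof.
move=> fixM; rewrite /body_spin mulmx_sumr mulmx_suml.
apply: eq_big_nat => j hj.
rewrite -scalemxAr -scalemxAl wedge_conj fixM; last by lia.
by rewrite /arm chain_fix // => l hl; apply: fixM; lia.
Qed.

(** The same infinitesimal rotation in the other frame, P' P^-1 instead of
    P^-1 P'. *)
Definition space_spin t i psi m : 'M[R]_n :=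
  block t i m *m body_spin t i psi m *m (block t i m)^T.

Lemma block_spin t i psi m : (0 < i <= m)%N -> (m <= n)%N ->
  block t i m *m body_spin t i psi m = space_spin t i psi m *m block t i m.
Proof.
move=> him le_mn; rewrite /space_spin -mulmxA.
by rewrite (mulmx1C (block_orth t him le_mn)) mulmx1.
Qed.

Lemma space_spin_id t i psi : space_spin t i psi i = 0.
Proof. by rewrite /space_spin body_spin_id mulmx0 mul0mx. Qed.

Lemma block_conj_arm t i m : (0 < i <= m)%N -> (m < n)%N ->
  block t i m *m wedge (arm t i m) (evec m.+1) *m (block t i m)^T
  = wedge (evec i) (evec m.+1).
Proof.
move=> him lt_mn; have le_im : (i <= m)%N by case/andP: him.
have pull k : evec k *m block t i m *m (block t i m)^T = evec k.
  by rewrite -mulmxA block_orth ?mulmx1 // ltnW.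
rewrite wedge_conj_tr -(evec_block t him (ltnW lt_mn)) pull.
by rewrite -{1}(evec_block_other t (k := m.+1) _ le_im) ?ltnSn ?orbT // pull.
Qed.

(** The new factor commutes with its own generator, so that it contributes
    the generator itself. *)
Lemma space_spin_recr t i psi m : (0 < i <= m)%N -> (m < n)%N ->
  space_spin t i psi m.+1 =
  rotation n i m.+1 (t i m.+1) *m space_spin t i psi m
    *m (rotation n i m.+1 (t i m.+1))^T
  + psi m.+1 *: wedge (evec i) (evec m.+1).
Proof.
move=> him lt_mn; have /andP[i_gt0 le_im] := him.
have him1 : (0 < i < m.+1)%N by rewrite i_gt0.
rewrite /space_spin block_recr // body_spin_recr // trmx_mul.
rewrite mulmxDr mulmxDl; congr (_ + _).
  by rewrite !mulmxA.
rewrite -scalemxAr -scalemxAl; congr (_ *: _).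
rewrite -[RHS](rotation_conj_wedge (t i m.+1) him1 lt_mn).
rewrite -(block_conj_arm t him lt_mn).
by rewrite !mulmxA.
Qed.

Lemma evec_space_spin_other t i psi m k : (0 < i <= m)%N -> (m <= n)%N ->
  (0 < k <= n)%N -> (k < i)%N || (m < k)%N ->
  evec k *m space_spin t i psi m = 0.
Proof.
move=> /andP[_ le_im] le_mn k_in hk.
rewrite /space_spin !mulmxA evec_block_other //.
by rewrite evec_body_spin_other // mul0mx.
Qed.

(** Each angular velocity is visible in the row [i], up to cosines; this is why
    that single row of the matrix equation determines all of them. *)
Lemma evec_space_spin t i psi m : (0 < i <= m)%N -> (m <= n)%N ->
  evec i *m space_spin t i psi m = chain (fun l => cos (t i l)) psi i.+1 m.
Proof.
case/andP=> i_gt0; move: m; apply: from_ind => [_|m le_im IHm lt_mn].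
  by rewrite space_spin_id mulmx0 chain_geq.
have him : (0 < i <= m)%N by rewrite i_gt0.
have him1 : (0 < i < m.+1)%N by rewrite i_gt0.
rewrite space_spin_recr // mulmxDr.
rewrite [evec i *m (_ *m space_spin _ _ _ _ *m _)]mulmxA (mulmxA (evec i)).
rewrite evec_rotation_fst // mulmxDl -!scalemxAl.
rewrite IHm 1?ltnW //.
rewrite evec_space_spin_other ?ltnSn ?orbT ?scaler0 ?addr0 // 1?ltnW //.
rewrite -scalemxAl chain_fix => [|j hj]; last first.
  rewrite trmx_rotation ?ltn_eqF // evec_rotation //; apply/eqP; lia.
rewrite -scalemxAr evec_wedge; last by lia.
by rewrite eqxx ltn_eqF // scale1r scale0r subr0 chain_recr.
Qed.

(** With [A] the value A_i, this is the curvature of index [i] at [m = n], and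
    up to a sine a term of the angle derivative of index [(i, j)] at [m = j]. *)
Definition flux (A : R) t i m : R :=
  \prod_(i.+2 <= l < m.+1) (cos (t i l) / cos (t i.+1 l)) * A.

Lemma flux_id A t i : flux A t i i.+1 = A.
Proof. by rewrite /flux big_geq // mul1r. Qed.

Lemma flux_recr A t i m : (i < m)%N -> cos (t i.+1 m.+1) != 0 ->
  flux A t i m.+1 * cos (t i.+1 m.+1) = flux A t i m * cos (t i m.+1).
Proof.
move=> lt_im c_neq0; rewrite /flux big_nat_recr //=.
set P := \prod_(_ <= l < _) _.
by field.
Qed.

(** The key identity, by induction on [m]. If the coefficients of the spin of
    block [i] are proportional to those of the row [i+1] in the way the
    constraints prescribe, then the spin splits into a rotation of e_i towards
    that row and an infinitesimal rotation of the positions after [i], which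
    has exactly the form of a [body_spin] of the next block. The equations of
    all levels have therefore the same form. *)
Lemma space_spin_level A t i phi m : (0 < i < m)%N -> (m <= n)%N ->
  (forall l, (i.+1 < l <= m)%N -> cos (t i.+1 l) != 0) ->
  (forall j, (i < j <= m)%N -> phi j = flux A t i j * sin1 t i.+1 j) ->
  space_spin t i phi m = flux A t i m *: wedge (evec i) (arm t i.+1 m)
    + body_spin t i.+1 (fun j => flux A t i j.-1 * sin (t i j)) m.
Proof.
case/andP=> i_gt0; move: m; apply: from_ind => [|m lt_im IHm] lt_mn c_neq0 hphi.
  rewrite space_spin_recr ?leqnn ?i_gt0 // space_spin_id.
  rewrite mulmx0 mul0mx add0r body_spin_id addr0.
  by rewrite hphi ?leqnn // /sin1 eqxx mulr1 arm_id.
have him : (0 < i <= m)%N by rewrite i_gt0 ltnW.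
have him1 : (0 < i < m.+1)%N by rewrite i_gt0 ltnW.
rewrite space_spin_recr // IHm; first last.
- by move=> j hj; apply: hphi; lia.
- by move=> l hl; apply: c_neq0; lia.
- exact: ltnW.
have rotfix j : (i < j <= m)%N ->
    evec j *m (rotation n i m.+1 (t i m.+1))^T = evec j.
  move=> hj; rewrite trmx_rotation; last by apply/eqP; lia.
  by rewrite evec_rotation //; apply/eqP; lia.
rewrite mulmxDr mulmxDl -[X in _ + X *m body_spin _ _ _ _ *m _]trmxK.
rewrite body_spin_conj //.
rewrite -scalemxAr -scalemxAl wedge_conj_tr.
rewrite {1}/arm chain_fix // -/(arm t i.+1 m).
rewrite trmx_rotation; last by apply/eqP; lia.
rewrite evec_rotation_fst // cosN sinN body_spin_recr // arm_recr // hphi;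
  last by lia.
rewrite /sin1 gtn_eqF // !(wedgeDl, wedgeDr, wedgeZl, wedgeZr) /=.
(* The remaining identity is linear in the three wedge products and in the
   spin of the next block. *)
rewrite (wedgeC _ (evec m.+1)).
set w1 := wedge _ _; set w2 := wedge _ _; set w3 := wedge _ _.
set g := body_spin _ _ _ _.
clearbody w1 w2 w3 g; rewrite !scalerDr !scalerA flux_recr //;
  last by apply: c_neq0; lia.
rewrite mulrN scalerN scaleNr opprK -!addrA; congr (_ + _).
by rewrite [LHS]addrC -addrA [RHS]addrCA.
Qed.

Lemma flux_tail A t i j m : (i < j)%N ->
  (forall l, (i.+1 < l)%N -> (l <= m)%N -> cos (t i.+1 l) != 0) -> (j <= m)%N ->
  flux A t i j * \prod_(j.+1 <= l < m.+1) cos (t i l)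
  = flux A t i m * \prod_(j.+1 <= l < m.+1) cos (t i.+1 l).
Proof.
move=> lt_ij + le_jm; move: m le_jm; apply: from_ind => [_|m le_jm IHm c_neq0].
  by rewrite !big_geq.
rewrite !(big_nat_recr m.+1) //= mulrA IHm => [|l ? ?];
  last by apply: c_neq0; lia.
rewrite mulrAC -flux_recr; [ring|lia|apply: c_neq0; lia].
Qed.

(** Converse reading of the prescribed coefficients: the row equation
    determines [phi] and [w] from [phi i.+1]. The cosine at [(i, i+2)] is never
    divided by: the coordinate [i+1] is solved for [w] by dividing by cosines
    of the row [i+1], and of the row [i] the later coordinates involve only the
    cosines at [(i, l)] with [l > i+2]. *)
Lemma level_unique t i phi w : (0 < i < n)%N ->
  (forall l, (i.+1 < l)%N -> (l <= n)%N -> cos (t i.+1 l) != 0) ->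
  (forall l, (i.+2 < l)%N -> (l <= n)%N -> cos (t i l) != 0) ->
  chain (fun l => cos (t i l)) phi i.+1 n = w *: arm t i.+1 n ->
  w = flux (phi i.+1) t i n /\
  (forall j, (i < j <= n)%N -> phi j = flux (phi i.+1) t i j * sin1 t i.+1 j).
Proof.
move=> hi c1 c0 eq_row; set A := phi i.+1.
have coord j : (i < j <= n)%N ->
    phi j * \prod_(j.+1 <= l < n.+1) cos (t i l)
    = w * (sin1 t i.+1 j * \prod_(j.+1 <= l < n.+1) cos (t i.+1 l)).
  case: j => // j /andP[lt_ij lt_jn].
  have := congr1 (fun a => a 0 (Ordinal lt_jn)) eq_row.
  by rewrite mxE !chainE /= !ltnS lt_jn -ltnS lt_ij.
have prod_neq0 (f : nat -> R) j :
    (forall l, (j < l)%N -> (l <= n)%N -> f l != 0) ->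
    \prod_(j.+1 <= l < n.+1) f l != 0.
  move=> f_neq0; rewrite prodf_seq_neq0; apply/allP => l.
  by rewrite mem_index_iota => /andP[lt_jl le_ln]; apply: f_neq0.
have [i_gt0 lt_in] := andP hi.
have wE : w = flux A t i n.
  have := coord i.+1; rewrite ltnSn lt_in => /(_ isT).
  rewrite -/A -{1}(flux_id A t i) (flux_tail A (t := t) (ltnSn i) c1 lt_in) //.
  rewrite /sin1 eqxx mul1r.
  by move/(mulIf (prod_neq0 _ _ c1)).
split=> // j hj; have [-> | neq_ji] := eqVneq j i.+1.
  by rewrite flux_id /sin1 eqxx mulr1.
have nz : \prod_(j.+1 <= l < n.+1) cos (t i l) != 0.
  by apply: prod_neq0 => l ? ?; apply: c0 => //; lia.
apply: (mulIf nz); rewrite coord // wE mulrCA.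
rewrite -(flux_tail A (t := t) (j := j) _ c1).
- by ring.
- by lia.
- by lia.
Qed.

(** * Peeling off one block *)

(** [tail t 2] is the gauge matrix; the recursion on [k] removes its rightmost
    block, which is the one of smallest first index. *)
Definition tail t k : 'M[R]_n :=
  mulmxs (rev [seq (i, j) | i <- iota k (n - k), j <- iota i.+1 (n - i)])
    (fun p => rotation n p.1 p.2 (t p.1 p.2)).

Lemma tail_n t : tail t n = 1%:M.
Proof. by rewrite /tail subnn /mulmxs big_nil. Qed.

Lemma tail_recl t k : (k < n)%N -> tail t k = tail t k.+1 *m block t k n.
Proof.
move=> lt_kn; rewrite /tail -[in LHS](subnSK lt_kn) /= rev_cat mulmxs_cat.
congr (_ *m _); rewrite /block /mulmxs -map_rev big_map.
by [].
Qed.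

Lemma tail_orth t k : (0 < k)%N -> (k <= n)%N ->
  tail t k *m (tail t k)^T = 1%:M.
Proof.
move=> + le_kn; move: k le_kn; apply: down_ind => [_|k lt_kn IHk k_gt0].
  by rewrite tail_n trmx1 mulmx1.
rewrite tail_recl // trmx_mul mulmxA -(mulmxA _ (block _ _ _)).
by rewrite block_orth ?k_gt0 ?(ltnW lt_kn) // mulmx1 IHk.
Qed.

Lemma evec_tail_other t k l : (l < k)%N -> (k <= n)%N ->
  evec l *m tail t k = evec l.
Proof.
move=> + le_kn; move: k le_kn; apply: down_ind => [_|k lt_kn IHk lt_lk].
  by rewrite tail_n mulmx1.
rewrite tail_recl // mulmxA IHk ?leqW //.
by rewrite evec_block_other ?lt_lk // ltnW.
Qed.

Lemma evec_tail t k : (0 < k <= n)%N -> evec k *m tail t k = arm t k n.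
Proof.
case/andP=> k_gt0; rewrite leq_eqVlt => /predU1P[-> | lt_kn].
  by rewrite tail_n arm_id mulmx1.
rewrite tail_recl // mulmxA evec_tail_other ?ltnSn // evec_block // ?leqnn //.
by rewrite k_gt0 ltnW.
Qed.

Definition frenet_from (w : nat -> R) k : 'M[R]_n :=
  \sum_(k <= j < n) w j *: wedge (evec j) (evec j.+1).

Lemma frenet_from_recl w k : (k < n)%N ->
  frenet_from w k = w k *: wedge (evec k) (evec k.+1) + frenet_from w k.+1.
Proof. by move=> lt_kn; rewrite /frenet_from big_ltn. Qed.

Lemma evec_frenet_from w k l : (0 < l < k)%N -> evec l *m frenet_from w k = 0.
Proof.
move=> hl; rewrite /frenet_from mulmx_sumr big_nat big1 // => j hj.
rewrite -scalemxAr evec_wedge; last by lia.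
rewrite (_ : l == j = false); last by apply/eqP; lia.
rewrite (_ : l == j.+1 = false); last by apply/eqP; lia.
by rewrite !scale0r subrr scaler0.
Qed.

(** [tail t k.+1] fixes e_k and sends e_(k+1) to its row [arm t k.+1 n]. *)
Lemma wedge_tail t k : (0 < k < n)%N ->
  wedge (evec k) (evec k.+1) *m tail t k.+1
  = tail t k.+1 *m wedge (evec k) (arm t k.+1 n).
Proof.
move=> hk; have /andP[k_gt0 lt_kn] := hk.
rewrite -evec_tail // -[in RHS](evec_tail_other t (ltnSn k) lt_kn) -wedge_conj.
by rewrite !mulmxA tail_orth // mul1mx.
Qed.

(** After cancelling block [i] on the right, the velocities [psi] of its angles
    and the terms [phi] inherited from block [i-1] enter only through their sum.
    The row [i] of what is left gives the equations for that sum, and by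
    [space_spin_level] the rest is the same equation for [i+1]. Here [D] stands
    for the derivative of [tail t i.+1]. *)
Lemma level_step t i (D : 'M[R]_n) psi phi w : (0 < i < n)%N ->
  (forall l, (i.+1 < l)%N -> (l <= n)%N -> cos (t i.+1 l) != 0) ->
  (forall l, (i.+2 < l)%N -> (l <= n)%N -> cos (t i l) != 0) ->
  evec i *m D = 0 ->
  let A := psi i.+1 + phi i.+1 in
  D *m block t i n + tail t i.+1 *m (block t i n *m body_spin t i psi n)
    + tail t i *m body_spin t i phi n = frenet_from w i *m tail t i
  <->
  [/\ w i = flux A t i n,
      forall j, (i < j <= n)%N ->
        psi j + phi j = flux A t i j * sin1 t i.+1 j
    & D + tail t i.+1
            *m body_spin t i.+1 (fun j => flux A t i j.-1 * sin (t i j)) n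
      = frenet_from w i.+1 *m tail t i.+1].
Proof.
move=> hi c1 c0 eD A; have /andP[i_gt0 lt_in] := hi.
have hin : (0 < i <= n)%N by rewrite i_gt0 ltnW.
pose chi j := psi j + phi j.
pose reduced :=
  D + tail t i.+1 *m space_spin t i chi n = frenet_from w i *m tail t i.+1.
have invP : block t i n *m (block t i n)^T = 1%:M by rewrite block_orth.
have reducedP :
    D *m block t i n + tail t i.+1 *m (block t i n *m body_spin t i psi n)
      + tail t i *m body_spin t i phi n = frenet_from w i *m tail t i
    <-> reduced.
  rewrite (tail_recl t lt_in) -addrA.
  rewrite -[_ *m block t i n *m body_spin t i phi n]mulmxA.
  rewrite -mulmxDr -mulmxDr -body_spinD block_spin // mulmxA -mulmxDl mulmxA.
  split=> [eqB | ->//]; have := congr1 (mulmx^~ (block t i n)^T) eqB.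
  by rewrite /= -[LHS]mulmxA -[RHS]mulmxA invP !mulmx1.
rewrite reducedP /reduced frenet_from_recl // mulmxDl -scalemxAl wedge_tail //.
have spinE :
    (forall j, (i < j <= n)%N -> chi j = flux A t i j * sin1 t i.+1 j) ->
    tail t i.+1 *m space_spin t i chi n
    = flux A t i n *: (tail t i.+1 *m wedge (evec i) (arm t i.+1 n))
      + tail t i.+1
          *m body_spin t i.+1 (fun j => flux A t i j.-1 * sin (t i j)) n.
  move=> chiE; rewrite (space_spin_level hi _ _ chiE) //.
    by rewrite mulmxDr -scalemxAr.
  by move=> l /andP[]; exact: c1.
split=> [eq_red | [wE chiE eq_next]]; last first.
  by rewrite spinE // -wE addrCA eq_next.
have [wE chiE] : w i = flux A t i n /\
    (forall j, (i < j <= n)%N -> chi j = flux A t i j * sin1 t i.+1 j).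
  apply: level_unique => //; rewrite -evec_space_spin //.
  have := congr1 (mulmx (evec i)) eq_red.
  rewrite (mulmxDr _ D) (mulmxDr _ (w i *: _)) eD add0r -scalemxAr.
  rewrite !(mulmxA (evec i) (tail t i.+1)).
  rewrite evec_tail_other // (mulmxA (evec i) (frenet_from w i.+1)).
  rewrite evec_frenet_from ?mul0mx ?addr0; last by rewrite i_gt0 ltnSn.
  move=> ->; congr (_ *: _).
  rewrite (mul_wedge (x := 1) (y := 0)); last by rewrite chain_dot //; lia.
    by rewrite scale1r scale0r subr0.
  by rewrite evec_dot // eqxx.
split=> //.
apply: (addrI (w i *: (tail t i.+1 *m wedge (evec i) (arm t i.+1 n)))).
by rewrite -eq_red spinE // wE addrCA.
Qed.

(** * Derivatives of the gauge matrix *)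

Definition is_dmx p q (F : R -> 'M[R]_(p, q)) (x : R) (dF : 'M[R]_(p, q)) :=
  forall (a : 'I_p) (b : 'I_q), is_derive x 1 (fun y => F y a b) (dF a b).

Lemma is_dmxE p q (F : R -> 'M[R]_(p, q)) x dF :
  is_dmx F x dF -> Dmx F x = dF.
Proof.
by move=> hF; apply/matrixP => a b; rewrite mxE derive1E; apply: derive_val.
Qed.

Lemma is_dmx_derivable p q (F : R -> 'M[R]_(p, q)) x dF :
  is_dmx F x dF -> derivable_mx F x.
Proof. by move=> hF a b; case: (hF a b). Qed.

Lemma derivable_is_dmx p q (F : R -> 'M[R]_(p, q)) x :
  derivable_mx F x -> is_dmx F x (Dmx F x).
Proof. by move=> hF a b; rewrite mxE derive1E; apply: derivableP. Qed.

Lemma is_dmx_cst p q (M : 'M[R]_(p, q)) x : is_dmx (fun=> M) x 0.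
Proof. by move=> a b; rewrite mxE; apply: is_derive_cst. Qed.

Lemma is_dmx_tr p q (F : R -> 'M[R]_(p, q)) x dF :
  is_dmx F x dF -> is_dmx (fun y => (F y)^T) x dF^T.
Proof.
move=> hF a b; rewrite mxE.
by under eq_fun do rewrite mxE.
Qed.

Lemma is_dmxM p q r (F : R -> 'M[R]_(p, q)) (G : R -> 'M[R]_(q, r)) x dF dG :
  is_dmx F x dF -> is_dmx G x dG ->
  is_dmx (fun y => F y *m G y) x (dF *m G x + F x *m dG).
Proof.
move=> hF hG a b.
rewrite (_ : (fun y => _) =
  \sum_k ((fun y => F y a k) * (fun y => G y k b))); last first.
  by apply/funext => y; rewrite mxE fct_sumE.
apply: (is_derive_eq
  (is_derive_sum (fun k : 'I_q => is_deriveM (hF a k) (hG k b)))).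
rewrite !mxE -big_split; apply: eq_bigr => k _ /=.
by rewrite addrC [G x k b *: _]mulrC.
Qed.

Lemma is_dmx_near p q (F G : R -> 'M[R]_(p, q)) x dF :
  (\forall y \near x, F y = G y) -> is_dmx F x dF -> is_dmx G x dF.
Proof.
move=> nFG hF a b; apply: near_eq_is_derive (hF a b).
by near do congr (fun_of_matrix _ a b).
Unshelve. all: by end_near.
Qed.

Lemma is_dmx_rotation i j (th : R -> R) x dth : (0 < i < j)%N -> (j <= n)%N ->
  is_derive x 1 th dth ->
  is_dmx (fun y => rotation n i j (th y)) x
    (dth *: (wedge (evec i) (evec j) *m rotation n i j (th x))).
Proof.
move=> hij le_jn dthP; have neq_ij : (i == j) = false by apply/eqP; lia.
have cosP : is_derive x 1 (fun y => cos (th y)) (- sin (th x) * dth).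
  exact: is_derive1_comp.
have sinP : is_derive x 1 (fun y => sin (th y)) (cos (th x) * dth).
  exact: is_derive1_comp.
have sinNP : is_derive x 1 (fun y => - sin (th y)) (- (cos (th x) * dth)).
  exact: is_deriveN.
have -> : wedge (evec i) (evec j) *m rotation n i j (th x)
    = (evec i)^T *m (- sin (th x) *: evec i + cos (th x) *: evec j)
      - (evec j)^T *m (cos (th x) *: evec i + sin (th x) *: evec j).
  by rewrite mulmxBl -!mulmxA evec_rotation_fst ?evec_rotation_snd.
have simp0 := (mulr0, mul0r, addr0, subr0).
move=> p q; under eq_fun do rewrite mxE.
rewrite !mxE !big_ord1 !mxE.
case: (eqVneq p.+1 i) => [pi|_]; case: (eqVneq q.+1 i) => [qi|_] /=.
- by rewrite pi qi neq_ij /=; apply: (is_derive_eq cosP); ring.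
- rewrite pi neq_ij /=; case: eqP => _ /=.
    by apply: (is_derive_eq sinP); ring.
  by apply: (is_derive_eq (is_derive_cst _ _ _)); rewrite ?simp0.
- rewrite qi neq_ij andbF andbT; case: eqP => _ /=.
    by apply: (is_derive_eq sinNP); ring.
  by apply: (is_derive_eq (is_derive_cst _ _ _)); rewrite ?simp0.
case: eqP => _ /=; last first.
  by apply: (is_derive_eq (is_derive_cst _ _ _)); rewrite ?simp0.
case: eqP => _ /=; first by apply: (is_derive_eq cosP); ring.
by apply: (is_derive_eq (is_derive_cst _ _ _)); rewrite ?simp0.
Qed.

Lemma wedge_rotation i j x : (0 < i < j)%N -> (j <= n)%N ->
  wedge (evec i) (evec j) *m rotation n i j x
  = rotation n i j x *m wedge (evec i) (evec j).
Proof.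
move=> hij le_jn; rewrite -{1}(rotation_conj_wedge x hij le_jn) -mulmxA.
by rewrite (mulmx1C (rotation_orth x hij le_jn)) mulmx1.
Qed.

Lemma is_dmx_block (th : nat -> nat -> R -> R) (x : R) i m :
  (0 < i <= m)%N -> (m <= n)%N ->
  (forall j, (i < j <= m)%N -> derivable (th i j) x 1) ->
  let t y j k := th j k y in
  is_dmx (fun y => block (t y) i m) x
    (block (t x) i m *m body_spin (t x) i (fun j => derive1 (th i j) x) m).
Proof.
move=> /andP[i_gt0 le_im] le_mn th_der t; move: m le_im le_mn th_der.
apply: from_ind => [|m le_im IHm] lt_mn th_der.
  rewrite body_spin_id mulmx0; under eq_fun do rewrite block_id.
  exact: is_dmx_cst.
have him : (0 < i <= m)%N by rewrite i_gt0.
have him1 : (0 < i < m.+1)%N by rewrite i_gt0.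
have dthP : is_derive x 1 (th i m.+1) (derive1 (th i m.+1) x).
  by rewrite derive1E; apply: derivableP; apply: th_der; rewrite ltnS le_im /=.
have IH : is_dmx (fun y => block (t y) i m) x
    (block (t x) i m *m body_spin (t x) i (fun j => derive1 (th i j) x) m).
  by apply: IHm => [|j hj]; [exact: ltnW | apply: th_der; lia].
have := is_dmxM (is_dmx_rotation him1 lt_mn dthP) IH.
under [X in is_dmx X]eq_fun do rewrite -block_recr //.
congr (is_dmx _ _ _).
rewrite -scalemxAl wedge_rotation // -mulmxA body_spin_recr //.
rewrite mulmxDr -scalemxAr.
rewrite [LHS]addrC block_recr // !mulmxA; congr (_ + _ *: _).
rewrite -[RHS]mulmxA -[LHS]mulmxA; congr (_ *m _).
rewrite -(block_conj_arm (t x) him lt_mn) -mulmxA.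
by rewrite (mulmx1C (block_orth (t x) him (ltnW lt_mn))) mulmx1.
Qed.

(** * The equation D T = Omega T level by level *)

Section Moving.
Variables (theta : nat -> nat -> R -> R) (x : R).
Hypothesis theta_der : forall i j, (2 <= i < j)%N -> (j <= n)%N ->
  derivable (theta i j) x 1.

Local Notation angles y := (fun i j => theta i j y).
Local Notation t := (angles x).
Local Notation dt i := (fun j => derive1 (theta i j) x).

Lemma is_dmx_tail_recl k D : (2 <= k < n)%N ->
  is_dmx (fun y => tail (angles y) k.+1) x D ->
  is_dmx (fun y => tail (angles y) k) x
    (D *m block t k n + tail t k.+1 *m (block t k n *m body_spin t k (dt k) n)).
Proof.
move=> /andP[k_gt1 lt_kn] tailP.
under [X in is_dmx X]eq_fun do rewrite tail_recl //.
apply: is_dmxM => //; apply: is_dmx_block => //.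
  by rewrite (ltnW k_gt1) ltnW.
by move=> j /andP[lt_kj le_jn]; apply: theta_der; rewrite ?k_gt1.
Qed.

Definition dtail k : 'M[R]_n := Dmx (fun y => tail (angles y) k) x.

Lemma is_dmx_tail k : (k <= n)%N -> (2 <= k)%N ->
  is_dmx (fun y => tail (angles y) k) x (dtail k).
Proof.
move=> le_kn k_gt1; apply: derivable_is_dmx; move: k le_kn k_gt1.
apply: down_ind => [_|k lt_kn IHk k_gt1].
  under eq_fun do rewrite tail_n.
  exact: is_dmx_derivable (is_dmx_cst _ _).
have tailP := derivable_is_dmx (IHk (leqW k_gt1)).
by apply: is_dmx_derivable (is_dmx_tail_recl _ tailP); rewrite k_gt1.
Qed.

Lemma dtail_recl k : (2 <= k < n)%N ->
  dtail k
  = dtail k.+1 *m block t k n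
    + tail t k.+1 *m (block t k n *m body_spin t k (dt k) n).
Proof.
move=> hk; apply: is_dmxE; apply: is_dmx_tail_recl => //.
by apply: is_dmx_tail; lia.
Qed.

Lemma evec_dtail l k : (l < k)%N -> (2 <= k <= n)%N -> evec l *m dtail k = 0.
Proof.
move=> lt_lk /andP[k_gt1 le_kn].
have := is_dmxM (is_dmx_cst (evec l) x) (is_dmx_tail le_kn k_gt1).
under [X in is_dmx X]eq_fun do rewrite evec_tail_other //.
by move/is_dmxE; rewrite mul0mx add0r => <-; apply/is_dmxE/is_dmx_cst.
Qed.

Lemma dtail_n : dtail n = 0.
Proof.
apply: is_dmxE; under eq_fun do rewrite tail_n.
exact: is_dmx_cst.
Qed.

(** The coefficients that block [i] receives from block [i-1]; they vanish for
    [i = 2] because A_1 = 0. *)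
Definition influx i j : R :=
  flux (A_rec theta i.-1 x) t i.-1 j.-1 * sin (t i.-1 j).

Definition level_equations (w : nat -> R) i :=
  w i = flux (A_rec theta i x) t i n /\
  forall j, (i < j <= n)%N ->
    dt i j + influx i j = flux (A_rec theta i x) t i j * sin1 t i.+1 j.

(** For [k = 2] this is D T = Omega T, where T is the gauge matrix and Omega the
    Frenet matrix without its first row and column. *)
Definition tail_equation (w : nat -> R) k :=
  dtail k + tail t k *m body_spin t k (influx k) n
  = frenet_from w k *m tail t k.

Hypothesis reg : regular_angles n theta x.

(** The recursion for A_i is the prescribed equation at [j = i+1]. *)
Lemma A_rec_influx i : (2 <= i)%N ->
  A_rec theta i x = dt i i.+1 + influx i i.+1.
Proof. by case: i => [|[|i]] // _; rewrite /influx /= flux_id mulrC. Qed.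

Lemma tail_equation_step w i : (2 <= i < n)%N ->
  tail_equation w i <-> level_equations w i /\ tail_equation w i.+1.
Proof.
move=> /andP[i_gt1 lt_in].
have hi : (0 < i < n)%N by rewrite ltnW.
rewrite /tail_equation dtail_recl ?i_gt1 // level_step //; first last.
- by apply: evec_dtail; rewrite ?ltnSn ?leqW.
- by move=> l hl le_ln; apply: reg; rewrite ?le_ln //; lia.
- by move=> l hl le_ln; apply: reg; rewrite ?le_ln //; lia.
rewrite -A_rec_influx // /level_equations /influx /=.
by split=> [[? ? ?] | [[? ?] ?]].
Qed.

Lemma tail_equation_levels w k : (k <= n)%N -> (2 <= k)%N ->
  tail_equation w k <-> forall i, (k <= i < n)%N -> level_equations w i.
Proof.
move: k; apply: down_ind => [_|k lt_kn IHk k_gt1].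
  rewrite /tail_equation dtail_n body_spin_id.
  rewrite /frenet_from big_geq // mul0mx mulmx0 addr0.
  by split=> // _ i; case: ltnP => // _; rewrite ltnNge.
rewrite tail_equation_step ?k_gt1 // IHk ?leqW //; split=> [[lk ltk] i | lev].
  rewrite leq_eqVlt => /andP[/predU1P[<- //|lt_ki] lt_in].
  by apply: ltk; rewrite lt_ki.
split; first by apply: lev; rewrite leqnn.
by move=> i /andP[lt_ki lt_in]; apply: lev; rewrite ltnW.
Qed.

Lemma levels_equiv (ubar : nat -> R -> R) :
  (forall i, (2 <= i < n)%N -> level_equations (fun j => ubar j x) i) <->
  frenet_curvatures n theta ubar x /\ angle_constraints n theta x.
Proof.
have influxE i j : (2 <= i < j)%N -> influx i j =
    \prod_(i.+1 <= l < j) (cos (theta i.-1 l x) / cos (theta i l x))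
      * sin (theta i.-1 j x) * A_rec theta i.-1 x.
  by case: i j => [|i] [|j] // _; rewrite /influx /flux /= mulrAC.
split=> [lev | [curv constr] i /andP[i_gt1 lt_in]].
  split=> [i hi | i j hij]; first by case: (lev i); [lia|].
  have [hi hj] : (2 <= i < n)%N /\ (i.+2 <= j <= n)%N.
    by move: hij; rewrite /constraint_index; lia.
  case: (lev i hi) => _ /(_ j) hlev; apply: (addIr (influx i j)).
  rewrite hlev; last by lia.
  rewrite influxE; last by lia.
  rewrite subrK /flux /sin1 (_ : j == i.+1 = false) 1?mulrAC //.
  by apply/eqP; lia.
split=> [|j hj]; first by apply: curv; lia.
have [-> | neq_ji] := eqVneq j i.+1.
  by rewrite -A_rec_influx // flux_id /sin1 eqxx mulr1.
rewrite constr; last by rewrite /constraint_index; lia.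
rewrite influxE; last by lia.
by rewrite subrK /flux /sin1 (negbTE neq_ji) mulrAC.
Qed.

End Moving.

(** * The gauge equation and the frames *)

Lemma frenet_cartanE (ubar : nat -> R -> R) x :
  frenet_cartan n ubar x = frenet_from (fun j => ubar j x) 1.
Proof.
apply/matrixP => p q; rewrite !mxE summxE.
transitivity (\sum_(1 <= j < n | j == p.+1) (ubar j x * (q.+1 == j.+1)%:R)
   - \sum_(1 <= j < n | j == q.+1) (ubar j x * (p.+1 == j.+1)%:R)).
  rewrite !big_nat1_eq !eqSS; have := ltn_ord p; have := ltn_ord q.
  case: (eqVneq (q : nat) p.+1) => [eqp | _].
    move=> lt_qn _; rewrite -eqp lt_qn mulr1 (_ : p == q.+1 :> nat = false).
      by rewrite mulr0 if_same subr0 eqp.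
    by apply/eqP; lia.
  rewrite mulr0 if_same sub0r => _ lt_pn.
  case: (eqVneq (p : nat) q.+1) => [eqp | _]; last first.
    by rewrite mulr0 if_same oppr0.
  by rewrite -eqp lt_pn mulr1 eqp.
rewrite !(big_mkcond (fun j => j == _)) -sumrB; apply: eq_bigr => j _.
rewrite !mxE !big_ord1 !mxE !(eq_sym j).
by case: (p.+1 == j) (q.+1 == j) => [] [];
  rewrite ?mul1r ?mul0r ?mulr1 ?mulrBr ?mulr0.
Qed.

Definition curvature_row (u : nat -> R -> R) x : 'rV[R]_n :=
  \row_q (if (0 < q)%N then u q x else 0).

Lemma natural_cartanE (u : nat -> R -> R) x :
  natural_cartan n u x = wedge (evec 1) (curvature_row u x).
Proof.
apply/matrixP => p q; rewrite !mxE !big_ord1 !mxE !eqSS.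
by case: (nat_of_ord p) (nat_of_ord q) => [|p'] [|q'] /=;
  rewrite ?mul1r ?mul0r ?mulr1 ?mulr0 ?subr0 ?sub0r ?subrr ?oppr0.
Qed.

Lemma euler_arm (theta : nat -> nat -> R -> R) (ubar u : nat -> R -> R) x :
  (1 < n)%N ->
  euler_transformation n theta ubar u x <->
  curvature_row u x = ubar 1%N x *: arm (fun i j => theta i j x) 2 n.
Proof.
move=> n_gt1; split=> [[eu1 euk] | eu].
  apply/rowP => q; rewrite !mxE chainE ltnS.
  case: (posnP q) => [q0 | q_gt0]; first by rewrite q0 /= mulr0.
  rewrite ltnS ltn_ord /=; have [q1 | neq_q1] := eqVneq (q : nat) 1%N.
    by rewrite q1 eu1 /sin1 eqxx mul1r.
  rewrite euk; last by have := ltn_ord q; lia.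
  by rewrite /sin1 (_ : q.+1 == 2 = false) ?mulrA //; apply/eqP; lia.
have coord k (lt_kn : (k < n)%N) : (0 < k)%N -> u k x = ubar 1%N x
    * (sin1 (fun i j => theta i j x) 2 k.+1
       * \prod_(k.+2 <= l < n.+1) cos (theta 2 l x)).
  move=> k_gt0; have := congr1 (fun a => a 0 (Ordinal lt_kn)) eu.
  by rewrite !mxE chainE /= k_gt0 !ltnS k_gt0 lt_kn.
split=> [|k hk]; first by rewrite (coord _ n_gt1) // /sin1 eqxx mul1r.
have lt_kn : (k < n)%N by lia.
rewrite (coord _ lt_kn); last by lia.
by rewrite /sin1 (_ : k.+1 == 2 = false) ?mulrA //; apply/eqP; lia.
Qed.

(** T fixes e_1, so that T (e_1 ^ p) = (e_1 ^ e_2) T for the second row p of T.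
    The gauge equation thus reads
    u_1 T (e_1 ^ p) + (Omega T - D T) = T (e_1 ^ U), with u_1 the first Frenet
    curvature and U the row of natural curvatures. Its first row is U = u_1 p,
    the Euler transformation, and what remains is D T = Omega T. *)
Lemma gauge_split (theta : nat -> nat -> R -> R) (ubar u : nat -> R -> R) x :
  (1 < n)%N ->
  (forall i j, (2 <= i < j)%N -> (j <= n)%N -> derivable (theta i j) x 1) ->
  gauge_equation n theta ubar u x <->
  euler_transformation n theta ubar u x
  /\ tail_equation theta x (fun j => ubar j x) 2.
Proof.
move=> n_gt1 th_der; rewrite euler_arm // /gauge_equation /tail_equation.
rewrite body_spin0 => [|j _]; last by rewrite /influx /flux /= mulr0 mul0r.
set t := fun i j => theta i j x; rewrite mulmx0 addr0.
rewrite -[gauge_mx n theta x]/(tail t 2) -[Dmx _ x]/(dtail theta x 2).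
rewrite frenet_cartanE natural_cartanE frenet_from_recl // mulmxDl -scalemxAl.
rewrite wedge_tail; last by rewrite n_gt1.
set T := tail t 2; set D := dtail theta x 2; set Om := frenet_from _ 2.
have fixT : evec 1 *m T = evec 1 by rewrite evec_tail_other.
have killD : evec 1 *m D = 0 by rewrite (evec_dtail th_der) ?n_gt1.
have killOm : evec 1 *m Om = 0 by rewrite evec_frenet_from.
have n_in : (0 < 1 <= n)%N by lia.
have wedge1 b : evec 1 *m b^T = 0%:M -> evec 1 *m wedge (evec 1) b = b.
  move=> b0; rewrite (mul_wedge (x := 1) (y := 0)) //.
    by rewrite scale1r scale0r subr0.
  by rewrite evec_dot // eqxx.
have armW : evec 1 *m wedge (evec 1) (arm t 2 n) = arm t 2 n.
  by apply: wedge1; rewrite chain_dot.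
have rowW : evec 1 *m wedge (evec 1) (curvature_row u x) = curvature_row u x.
  have n_gt0 : (0 < n)%N by case/andP: n_in.
  apply: wedge1; rewrite (evec_ord (Ordinal n_gt0)) -rowE.
  by apply/rowP => q; rewrite !mxE mul0rn.
split=> [eqG | [eqU ->]]; last by rewrite eqU wedgeZr -scalemxAr addrK.
have eqU : curvature_row u x = ubar 1%N x *: arm t 2 n.
  have := congr1 (mulmx (evec 1)) eqG.
  rewrite mulmxBr killD subr0 (mulmxDr _ (_ *: (T *m _))) -scalemxAr.
  rewrite (mulmxA _ Om) killOm mul0mx addr0 !(mulmxA _ T) fixT armW rowW.
  by move=> ->.
split=> //; move: eqG; rewrite eqU wedgeZr -scalemxAr -addrA.
by move/(canRL (addKr _)); rewrite addNr => /subr0_eq.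
Qed.

(** Differentiating Ebar = M E gives Wbar M E = M' E + M E'. Comparing this
    with E' = W E and cancelling the orthogonal matrix E or M gives the two
    directions. Openness of [I] is what allows differentiating an identity that
    holds on [I] only. *)
Lemma frame_change (I : set R) (c : R -> 'rV[R]_n)
    (wbar w M Ebar E : R -> 'M[R]_n) : open I ->
  (forall x, I x -> derivable_mx M x) ->
  (forall x, I x -> M x *m (M x)^T = 1%:M) ->
  (forall x, I x -> evec 1 *m M x = evec 1) ->
  moving_frame I c wbar Ebar ->
  (forall x, I x -> Ebar x = M x *m E x) ->
  (moving_frame I c w E <->
   forall x, I x -> wbar x *m M x - Dmx M x = M x *m w x).
Proof.
move=> hI derM orthM fixM hbar hE; split=> [hw x Ix | gauge x Ix].
  have [orthE _ _ derE DE] := hw x Ix.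
  have [_ _ _ _ Dbar] := hbar x Ix.
  have DbarE : Dmx Ebar x = Dmx M x *m E x + M x *m Dmx E x.
    apply: is_dmxE; apply: (is_dmx_near (F := fun y => M y *m E y)); last first.
      exact: is_dmxM (derivable_is_dmx (derM x Ix)) (derivable_is_dmx derE).
    by apply: filterS (open_nbhs_nbhs (conj hI Ix)) => y Iy; rewrite hE.
  have : wbar x *m M x *m E x = (Dmx M x + M x *m w x) *m E x.
    by rewrite mulmxDl -!mulmxA -DE -hE // -Dbar.
  move/(congr1 (mulmx^~ (E x)^T)); rewrite /= -!mulmxA orthE !mulmx1 => ->.
  by rewrite addrC addKr.
have [orthEbar derc row0 derEbar Dbar] := hbar x Ix.
have EE y : I y -> E y = (M y)^T *m Ebar y.
  by move=> Iy; rewrite hE // mulmxA (mulmx1C (orthM y Iy)) mul1mx.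
have EP : is_dmx E x ((Dmx M x)^T *m Ebar x + (M x)^T *m Dmx Ebar x).
  apply: (is_dmx_near (F := fun y => (M y)^T *m Ebar y)); last first.
    apply: is_dmxM (derivable_is_dmx derEbar).
    exact: is_dmx_tr (derivable_is_dmx (derM x Ix)).
  by apply: filterS (open_nbhs_nbhs (conj hI Ix)) => y Iy; rewrite EE.
have derE := is_dmx_derivable EP.
have DbarE : Dmx Ebar x = Dmx M x *m E x + M x *m Dmx E x.
  apply: is_dmxE; apply: (is_dmx_near (F := fun y => M y *m E y)); last first.
    exact: is_dmxM (derivable_is_dmx (derM x Ix)) (derivable_is_dmx derE).
  by apply: filterS (open_nbhs_nbhs (conj hI Ix)) => y Iy; rewrite hE.
split=> //.
- rewrite EE // trmx_mul trmxK -mulmxA (mulmxA (Ebar x)) orthEbar mul1mx.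
  exact/mulmx1C/orthM.
- move=> p p0; rewrite -(row0 p p0) !rowE.
  have -> : delta_mx 0 p = evec 1 by rewrite -evec_ord p0.
  by rewrite hE // mulmxA fixM.
have : M x *m Dmx E x = M x *m (w x *m E x).
  apply: (addrI (Dmx M x *m E x)); rewrite -DbarE Dbar hE // !mulmxA -mulmxDl.
  by rewrite -gauge // addrC subrK.
move/(congr1 (mulmx (M x)^T)); rewrite !mulmxA.
by rewrite (mulmx1C (orthM x Ix)) !mul1mx.
Qed.

(** For each [j] there are j - 3 values of [i], and these numbers add up to a
    binomial coefficient. *)
Lemma card_constraints :
  #|[pred p : 'I_n.+1 * 'I_n.+1 | constraint_index n p.1 p.2]|
  = ((n - 2) * (n - 3))./2.
Proof.
rewrite -sum1_card.
transitivity (\sum_(j < n.+1) \sum_(i < n.+1 | constraint_index n i j) 1)%N.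
  rewrite (exchange_big_dep xpredT) //= pair_big_dep /=.
  by apply: eq_bigl => -[i j].
transitivity (\sum_(j < n.+1) (j - 3))%N.
  apply: eq_bigr => j _; rewrite /constraint_index.
  have le_jn : (j <= n)%N by rewrite -ltnS.
  rewrite le_jn andbT; have [le_4j | lt_j4] := leqP 4 j; last first.
    by rewrite big_pred0 //; lia.
  rewrite -(big_mkord (fun i => 2 <= i <= j - 2)%N (fun=> 1%N)).
  transitivity (\sum_(2 <= i < j.-1) 1)%N; last first.
    by rewrite sum_nat_const_nat; lia.
  rewrite (big_nat_widenl 2 0) // (big_nat_widen 0 j.-1 n.+1); last by lia.
  by apply: eq_bigl => i; lia.
rewrite (_ : (n - 3) = (n - 2).-1)%N ?subnS // -bin2.
elim: n => [|m IHm]; first by rewrite big_ord1.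
rewrite big_ord_recr /= IHm; case: m {IHm} => [|[|m]] //.
by rewrite !subSS !subn0 binS bin1.
Qed.

End Gauge.

Theorem theorem1 (R : realType) (n : nat) (hn : (3 <= n)%N)
    (I : set R) (hI : open I)
    (theta : nat -> nat -> R -> R) (ubar u : nat -> R -> R)
    (htheta : forall i j, (2 <= i < j)%N -> (j <= n)%N ->
       forall x, I x -> derivable (theta i j) x 1) :
  [/\ (* R is orthogonal *)
      forall x, I x -> gauge_mx n theta x *m (gauge_mx n theta x)^T = 1%:M,
      (* the gauge equation says that ebar = R e relates the two frames *)
      forall (c : R -> 'rV[R]_n) (Ebar E : R -> 'M[R]_n),
        frenet_frame I c ubar Ebar ->
        (forall x, I x -> Ebar x = gauge_mx n theta x *m E x) ->
        (natural_frame I c u E <->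
         forall x, I x -> gauge_equation n theta ubar u x),
      forall x, I x ->
        gauge_equation n theta ubar u x -> euler_transformation n theta ubar u x,
      forall x, I x -> regular_angles n theta x ->
        (gauge_equation n theta ubar u x <->
         [/\ euler_transformation n theta ubar u x,
             frenet_curvatures n theta ubar x
           & angle_constraints n theta x])
    & (* the number of constraints *)
      #|[pred p : 'I_n.+1 * 'I_n.+1 | constraint_index n p.1 p.2]|
      = ((n - 2) * (n - 3))./2].
Proof.
have n_gt1 : (1 < n)%N by lia.
have theta_der x (Ix : I x) i j (hij : (2 <= i < j)%N) (le_jn : (j <= n)%N) :
  derivable (theta i j) x 1 by exact: htheta.
have orth x : gauge_mx n theta x *m (gauge_mx n theta x)^T = 1%:M.
  by apply: (@tail_orth R n (fun i j => theta i j x) 2).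
have der x : I x -> derivable_mx (gauge_mx n theta) x.
  by move=> Ix; exact: is_dmx_derivable (is_dmx_tail (theta_der x Ix) n_gt1 _).
have fix1 x : evec R n 1 *m gauge_mx n theta x = evec R n 1.
  by apply: (@evec_tail_other R n (fun i j => theta i j x)).
split=> [// | c Ebar E hbar hE | | |].
- exact: (frame_change (natural_cartan n u) hI der (fun x _ => orth x)
    (fun x _ => fix1 x) hbar hE).
- by move=> x Ix /(gauge_split _ _ n_gt1 (theta_der x Ix))[].
- move=> x Ix reg; rewrite (gauge_split _ _ n_gt1 (theta_der x Ix)).
  rewrite (tail_equation_levels (theta_der x Ix) reg) // levels_equiv.
  by split=> [[? []] | []].
- exact: card_constraints.
Qed.
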